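(* Let $n\ge 0$. For any number of agents $k\ge 2$, there is no online exploration algorithm for the class of $n$-tadpole graphs with competitive ratio smaller than $1.5$ in the time model.
   Context: Multi-agent online graph exploration: an undirected connected graph $G=(V,E)$ with positive edge lengths $l(e)$ and distinctly labelled nodes is initially unknown. $k$ agents start at a node $s$; initially they know $s$, its incident edges (with lengths) and its neighbours. Whenever an agent visits a node $v$ for the first time, all edges incident to $v$ (with lengths) and the neighbours of $v$ are revealed. Agents share all information instantly, have unlimited computation, move at unit speed (traversing $e$ takes time $l(e)$), and may wait. The exploration is finished when every node has been visited and all agents are back at $s$. Time model: cost is the finishing time. $opt(G,s,k)$ is the minimum cost of an exploration by $k$ agents with full prior knowledge of $G$; an algorithm has competitive ratio $c$ on a class if $c$ is the supremum of its cost divided by $opt(G,s,k)$ over all $G$ in the class and $s\in V$. An $n$-tadpole graph consists of a cycle to which $n$ tails (paths, each with at least one edge, attached at one endpoint to a cycle node) are attached; several tails may be attached to the same cycle node. A cycle is a $0$-tadpole graph and a tadpole graph is a $1$-tadpole graph. *)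

(* Defs.v *)
From HB Require Import structures.
From mathcomp Require Import all_boot all_order all_algebra.
From mathcomp Require Import finmap.
From mathcomp Require Import boolp classical_sets reals constructive_ereal ereal.

Set Implicit Arguments.
Unset Strict Implicit.
Unset Printing Implicit Defensive.

Import Order.TTheory GRing.Theory Num.Theory.
Local Open Scope fset_scope.
Local Open Scope ring_scope.

(* Node labels are natural numbers. The values of [len] off the edges are
   irrelevant. *)
Record wgraph (R : realType) := WGraph {
  nodes : {fset nat};
  edge : rel nat;
  len : nat -> nat -> R;
  edge_sym : symmetric edge;
  edge_irr : irreflexive edge;
  edge_nodes : forall x y, edge x y -> x \in nodes;
  len_sym : forall x y, edge x y -> len x y = len y x;
  len_gt0 : forall x y, edge x y -> 0 < len x y;
  edge_connected : {in nodes &, forall x y, exists2 p, path edge x p & last x p = y}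
}.

Section TadpoleGraphs.
Variable R : realType.
Implicit Types (G : wgraph R) (n : nat).

Definition path_links (p : seq nat) : seq (nat * nat) := zip p (behead p).

Definition cycle_links (c : seq nat) : seq (nat * nat) := zip c (rot 1 c).

(* A tail is a pair (a, p): the path a :: p, whose endpoint a lies on the cycle
   and whose other nodes p (at least one) are new. *)
Definition tadpole n G : Prop :=
  exists (c : seq nat) (tails : n.-tuple (nat * seq nat)),
    let V := c ++ flatten [seq a.2 | a <- tails] in
    let E := cycle_links c ++
             flatten [seq path_links (a.1 :: a.2) | a <- tails] in
    [/\ (2 < size c)%N,
        all (fun a => (a.1 \in c) && (a.2 != [::])) tails,
        uniq V,
        nodes G =i V &
        forall x y, edge G x y = ((x, y) \in E) || ((y, x) \in E)].

End TadpoleGraphs.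

Section Exploration.
Variables (R : realType) (k : nat).
Implicit Types (G : wgraph R) (s v w : nat) (t u : R).

(* The leg (d, y) of a route: leave the current node at (absolute) time d along
   the edge to y. An agent waits between its legs, at nodes only, and an edge
   that has been entered is traversed completely. After its last leg an agent
   stays where it is. *)
Definition route := seq (R * nat).
Definition schedule := 'I_k -> route.

(* The agent is at node x from time t0 on. *)
Fixpoint feasible_route G (x : nat) (t0 : R) (r : route) : bool :=
  if r is (d, y) :: r' then
    [&& t0 <= d, edge G x y & feasible_route G y (d + len G x y) r']
  else true.

Definition feasible G s (S : schedule) : Prop :=
  forall i, feasible_route G s 0 (S i).

(* An agent that is at x from time t0 on, and follows r, is at node v at time t
   (inside an edge it is at no node). *)
Fixpoint at_node G (x : nat) (t0 : R) (r : route) (v : nat) (t : R) : bool :=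
  if r is (d, y) :: r' then
    [&& x == v, t0 <= t & t <= d] || at_node G y (d + len G x y) r' v t
  else (x == v) && (t0 <= t).

Definition visited G s (S : schedule) t v : Prop :=
  exists (i : 'I_k) (u : R), u <= t /\ at_node G s 0 (S i) v u.

Definition finished G s (S : schedule) t : Prop :=
  (forall v, v \in nodes G -> visited G s S t v) /\
  (forall i, at_node G s 0 (S i) s t).

Local Open Scope ereal_scope.

(* +oo if the schedule never completes the exploration *)
Definition cost G s (S : schedule) : \bar R :=
  ereal_inf [set t%:E | t in [set t | finished G s S t]]%classic.

Definition opt G s : \bar R :=
  ereal_inf [set cost G s S | S in [set S | feasible G s S]]%classic.

Local Close Scope ereal_scope.

(* What is revealed when v is visited. *)
Definition incident G v w : option R :=
  if edge G v w then Some (len G v w) else None.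

(* Up to and including time t, the agents have received the same information
   at the same times in both runs. *)
Definition same_information s G1 (S1 : schedule) G2 (S2 : schedule) t : Prop :=
  (forall u v, u <= t -> visited G1 s S1 u v <-> visited G2 s S2 u v) /\
  (forall v w, visited G1 s S1 t v -> incident G1 v w = incident G2 v w).

Definition departures (r : route) t : route := [seq m <- r | m.1 <= t].

(* A deterministic online algorithm, given by the schedule that it produces on
   each input. Its moves depend only on the information received so far: as long
   as two inputs have revealed the same, the agents make the same moves. *)
Definition online_algorithm (C : wgraph R -> Prop)
    (A : wgraph R -> nat -> schedule) : Prop :=
  (forall G s, C G -> s \in nodes G -> feasible G s (A G s)) /\
  (forall G1 G2 s, C G1 -> C G2 -> s \in nodes G1 -> s \in nodes G2 ->
     forall t, same_information s G1 (A G1 s) G2 (A G2 s) t ->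
     forall i, departures (A G1 s i) t = departures (A G2 s i) t).

Local Open Scope ereal_scope.

Definition competitive_ratio (C : wgraph R -> Prop)
    (A : wgraph R -> nat -> schedule) : \bar R :=
  ereal_sup [set q | exists G s,
    [/\ C G, s \in nodes G & q = cost G s (A G s) / opt G s]]%classic.

End Exploration.

(* Main.v *)
Require Import Defs.
From mathcomp Require Import all_boot all_order all_algebra.
From mathcomp Require Import finmap zify lra.
From mathcomp Require Import boolp reals constructive_ereal ereal.

Set Implicit Arguments.
Unset Strict Implicit.
Unset Printing Implicit Defensive.

Import Order.TTheory GRing.Theory Num.Theory.
Local Open Scope ring_scope.

(* The start node s is joined to a node b by an edge of length 1, and on the
   other side starts a path of edges of tiny length eps. While the edge sb is
   not entered, the cycle looks like it has N = 1/eps path edges followed by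
   another edge of length 1 to b; there the optimum is about 2. If no agent
   enters sb before time 1, then b is reached at time 2 at the earliest and the
   cost is at least 3. If an agent enters sb at time d < 1, then only path nodes
   at distance at most y <= d have been visited, where y is d rounded down to a
   multiple of eps, and the adversary closes the cycle by a tiny edge two steps
   further. The optimum is then about 2y, but the agent inside sb needs time
   d + 1 + y >= 2y + 1 >= 3y to get home. The n tails are single edges of length
   eps at s, so they cost the optimum only 2 n eps.

   In the formalization b = 0, s = 1, the path is 1, ..., j + 1, and the tails
   end in T, ..., T + n - 1. *)

(** * Single routes: speed bounds, legs and departures *)

Section Routes.
Variable R : realType.
Implicit Types (G : wgraph R) (r : route R) (t u d e : R) (x y v w : nat).

(** Stands in for shortest-path distances: any such function certifies lower bounds on travel times.
    As edges are symmetric, the one-sided inequality makes [phi] 1-Lipschitz. *)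
Definition potential G (phi : nat -> R) :=
  forall x y, edge G x y -> phi y - phi x <= len G x y.

Lemma potential0 G : potential G (fun=> 0).
Proof. by move=> x y /len_gt0 /ltW; rewrite subr0. Qed.

Lemma potentialN G phi : potential G phi -> potential G (fun x => - phi x).
Proof.
move=> pot x y exy; rewrite (len_sym exy).
by have := pot y x; rewrite (edge_sym G) => /(_ exy); lra.
Qed.

Lemma at_node_start G x t r : feasible_route G x t r -> at_node G x t r x t.
Proof.
by case: r => [|[d y] r] /=; rewrite eqxx lexx // => /andP[-> _].
Qed.

Lemma at_node_potential G phi x t r v u :
  potential G phi -> feasible_route G x t r -> at_node G x t r v u ->
  phi v - phi x <= u - t.
Proof.
move=> pot; elim: r x t => [|[d y] r IH] x t /=.
  by move=> _ /andP[/eqP<-]; lra.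
move=> /and3P[td exy fr] /orP[/and3P[/eqP<-]|/(IH _ _ fr)]; first lra.
by have := pot _ _ exy; lra.
Qed.

Lemma at_node_ge G x t r v u :
  feasible_route G x t r -> at_node G x t r v u -> t <= u.
Proof. by move=> fr /(at_node_potential (@potential0 G) fr); lra. Qed.

Lemma at_node_potential2 G phi x t r v u w u' :
  potential G phi -> feasible_route G x t r ->
  at_node G x t r v u -> at_node G x t r w u' -> u <= u' ->
  phi w - phi v <= u' - u.
Proof.
move=> pot; elim: r x t => [|[d y] r IH] x t /=.
  by move=> _ /andP[/eqP<- _] /andP[/eqP<- _]; lra.
move=> /and3P[td exy fr] /orP[/and3P[/eqP<- tu ud]|av].
  move=> /orP[/and3P[/eqP<-]|/(at_node_potential pot fr)]; first lra.
  by have := pot _ _ exy; lra.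
(* If [w] is met before the departure, then [v] is met an edge of positive length later, against
   [u <= u']. *)
move=> /orP[/and3P[/eqP<- _ u'd]|aw]; last exact: IH fr av aw.
by have := at_node_ge fr av; have := len_gt0 exy; lra.
Qed.

(** A leg stores only its target, so its source is recovered by threading the current node through
    the route. *)
Fixpoint has_leg x r y d v : bool :=
  if r is (d0, z) :: r' then
    [&& x == y, d0 == d & z == v] || has_leg z r' y d v
  else false.

Lemma has_leg_cat x r r' y d v :
  has_leg x r y d v -> has_leg x (r ++ r') y d v.
Proof. by elim: r x => //= -[d0 z] r IH x /orP[->//|/IH ->]; rewrite orbT. Qed.

Lemma has_leg_departs G x t r y d v :
  feasible_route G x t r -> has_leg x r y d v ->
  [/\ edge G y v, t <= d, at_node G x t r y d & at_node G x t r v (d + len G y v)].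
Proof.
elim: r x t => //= -[d0 z] r IH x t /and3P[td exz fr].
case/orP=> [/and3P[/eqP xy /eqP dd /eqP zv]|/(IH _ _ fr)[? ltd -> ->]].
  by subst; rewrite at_node_start // exz td eqxx lexx orbT.
by rewrite !orbT; split=> //; have := len_gt0 exz; lra.
Qed.

(** An edge once entered is traversed completely. The inequality [d < u] is strict because at time
    [d] the agent still stands at [y]. *)
Lemma has_leg_inside G x t r y d v w u :
  feasible_route G x t r -> has_leg x r y d v ->
  at_node G x t r w u -> d < u -> d + len G y v <= u.
Proof.
elim: r x t => //= -[d0 z] r IH x t /and3P[td exz fr].
case/orP=> [/and3P[/eqP xy /eqP dd /eqP zv]|hl].
  subst; case/orP=> [/and3P[_ _]|/(at_node_ge fr) //]; lra.
case/orP=> [/and3P[_ _ ud]|aw]; last exact: IH fr hl aw.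
have [_ le_d _ _] := has_leg_departs fr hl.
by have := len_gt0 exz; lra.
Qed.

(** An agent away from its start came in by some leg; the lower bound on the arrival at node 0 will
    distinguish the sources of that leg. *)
Lemma last_leg G x t r v u :
  feasible_route G x t r -> at_node G x t r v u -> x != v ->
  exists y d, [/\ has_leg x r y d v & d + len G y v <= u].
Proof.
elim: r x t => [|[d z] r IH] x t /=.
  by move=> _ /andP[/eqP-> _]; rewrite eqxx.
move=> /and3P[td exz fr] /orP[/and3P[/eqP-> _ _]|av xv]; first by rewrite eqxx.
have [zv|zv] := eqVneq z v.
  exists x, d; rewrite !eqxx; split=> //.
  by rewrite -zv; exact: at_node_ge fr av.
have [y [d' [hl le]]] := IH _ _ fr av zv.
by exists y, d'; rewrite hl orbT.
Qed.

Lemma departures_nil G x t r u :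
  feasible_route G x t r -> u < t -> departures r u = [::].
Proof.
elim: r x t => //= -[d z] r IH x t /and3P[td exz fr] ut.
rewrite ifF; first by apply: IH fr _; have := len_gt0 exz; lra.
by apply/negbTE; rewrite -ltNge /=; lra.
Qed.

(** Departure times increase along a feasible route, so the filter in [departures] only cuts off a
    suffix. *)
Lemma departures_prefix G x t r u :
  feasible_route G x t r -> exists r', r = departures r u ++ r'.
Proof.
elim: r x t => [|[d z] r IH] x t /=; first by exists [::].
move=> /and3P[td exz fr]; have [le|lt] := leP d u.
  by have [r' {1}->] := IH _ _ fr; exists r'.
have dn : departures r u = [::].
  by apply: (departures_nil fr); have := len_gt0 exz; lra.
by exists ((d, z) :: r); rewrite -/(departures r u) dn.
Qed.

Lemma departures_has_leg G x t r y d v :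
  feasible_route G x t r -> has_leg x r y d v ->
  has_leg x (departures r d) y d v.
Proof.
elim: r x t => //= -[d0 z] r IH x t /and3P[td exz fr].
case/orP=> [/and3P[/eqP xy /eqP dd /eqP zv]|hl].
  by subst; rewrite lexx /= !eqxx.
have [_ le_d _ _] := has_leg_departs fr hl.
rewrite ifT /=; last by have := len_gt0 exz; lra.
by rewrite [has_leg z _ _ _ _](IH _ _ fr hl) orbT.
Qed.

(** Only legs departing by [u - e] can matter for presence at a new node by time [u], since no edge
    of [G1] is shorter than [e]. Those legs coincide in both routes, and their lengths have been
    revealed. *)
Lemma same_departures_visit G1 G2 e x t r1 r2 u v :
  (forall y w, edge G1 y w -> e <= len G1 y w) ->
  (forall y w u', u' <= u - e -> at_node G1 x t r1 y u' ->
     incident G1 y w = incident G2 y w) ->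
  feasible_route G1 x t r1 -> feasible_route G2 x t r2 ->
  departures r1 (u - e) = departures r2 (u - e) ->
  (exists2 u', u' <= u & at_node G1 x t r1 v u') ->
  exists2 u', u' <= u & at_node G2 x t r2 v u'.
Proof.
move=> le_e; elim: r1 x t r2 => [|[d y] r1 IH] x t r2 inc fr1 fr2 dep [u' u'u av].
  exists t; last by move: av => /= /andP[/eqP<- _]; exact: at_node_start.
  by apply: le_trans u'u; exact: at_node_ge fr1 av.
have tu : t <= u by apply: le_trans u'u; exact: at_node_ge fr1 av.
have start1 := at_node_start fr1.
have [xv|xv] := eqVneq x v.
  by exists t; rewrite // -xv; exact: at_node_start.
move: fr1 av => /= /and3P[td exy fr1]; rewrite (negbTE xv) /= => av.
have du : d <= u - e.
  by have := at_node_ge fr1 av; have := le_e _ _ exy; lra.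
move: dep; rewrite /= du; case: r2 fr2 => [//|[d' y'] r2] /=.
move=> /and3P[td' exy' fr2]; have [d'u|d'u] := leP d' (u - e); last first.
  rewrite (departures_nil fr2) //.
  by have := len_gt0 exy'; lra.
case=> dd' yy' dep; subst d' y'.
(* The source [x] is visited at [t <= d <= u - e], so both agents reach [y] at the same time. *)
have xinc : incident G1 x y = incident G2 x y.
  by apply: (inc _ _ t) => //; lra.
have ll : len G1 x y = len G2 x y by move: xinc; rewrite /incident exy exy' => -[].
rewrite -ll in fr2 *.
have inc' z w u2 : u2 <= u - e -> at_node G1 y (d + len G1 x y) r1 z u2 ->
    incident G1 z w = incident G2 z w.
  by move=> u2u az; apply: inc u2u _; rewrite /= az orbT.
have [|w' w'u aw] := IH _ _ r2 inc' fr1 fr2 dep; first by exists u'.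
by exists w'; rewrite // aw orbT.
Qed.

(** * Walks without waiting, and tours *)

Fixpoint walk_length G x (p : seq nat) : R :=
  if p is y :: p' then len G x y + walk_length G y p' else 0.

Fixpoint walk_route G x t (p : seq nat) : route R :=
  if p is y :: p' then (t, y) :: walk_route G y (t + len G x y) p' else [::].

Lemma walk_length_cat G x p q :
  walk_length G x (p ++ q) = walk_length G x p + walk_length G (last x p) q.
Proof. by elim: p x => [|y p IH] x /=; rewrite ?add0r // IH addrA. Qed.

Lemma walk_length_ge0 G x p : path (edge G) x p -> 0 <= walk_length G x p.
Proof.
elim: p x => //= y p IH x /andP[/len_gt0 lt /IH]; lra.
Qed.

Lemma walk_route_feasible G x t p :
  path (edge G) x p -> feasible_route G x t (walk_route G x t p).
Proof. by elim: p x t => //= y p IH x t /andP[-> /IH ->]; rewrite lexx. Qed.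

Lemma walk_route_last G x t p u :
  t + walk_length G x p <= u -> at_node G x t (walk_route G x t p) (last x p) u.
Proof.
elim: p x t => /= [|y p IH] x t; first by rewrite addr0 eqxx.
by rewrite addrA => /IH ->; rewrite orbT.
Qed.

Lemma walk_route_visits G x t p v :
  path (edge G) x p -> v \in x :: p ->
  exists2 u, u <= t + walk_length G x p & at_node G x t (walk_route G x t p) v u.
Proof.
elim: p x t => [|y p IH] x t /=.
  by rewrite inE => _ /eqP->; exists t; rewrite ?addr0 ?eqxx ?lexx.
move=> /andP[exy py]; rewrite inE => /orP[/eqP->|vp].
  exists t; rewrite ?eqxx ?lexx //.
  by have := len_gt0 exy; have := walk_length_ge0 py; lra.
have [u le_u au] := IH y (t + len G x y) py vp.
by exists u; rewrite ?au ?orbT // addrA.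
Qed.

(** Both [V] and [t] are only bounds, from below on what is covered and from above on the length, so
    that tours are easily glued at a common base point. *)
Definition closed_walk G x (V : seq nat) t :=
  exists p, [/\ path (edge G) x p, last x p = x, {subset V <= x :: p} &
                walk_length G x p <= t].

Lemma closed_walk_nil G x : closed_walk G x [::] 0.
Proof. by exists [::]; split. Qed.

Lemma closed_walk_start G x : closed_walk G x [:: x] 0.
Proof. by exists [::]; split. Qed.

Lemma closed_walk_le G x V t t' :
  t <= t' -> closed_walk G x V t -> closed_walk G x V t'.
Proof. by move=> tt' [p [pp pl pV plen]]; exists p; split=> //; lra. Qed.

Lemma closed_walk_cat G x V1 V2 t1 t2 :
  closed_walk G x V1 t1 -> closed_walk G x V2 t2 ->
  closed_walk G x (V1 ++ V2) (t1 + t2).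
Proof.
move=> [p [pp pl pV plen]] [q [qp ql qV qlen]]; exists (p ++ q).
rewrite cat_path last_cat walk_length_cat pl pp qp ql; split=> //; last lra.
move=> v; rewrite mem_cat inE mem_cat => /orP[/pV|/qV]; rewrite inE => /orP[]->;
  by rewrite ?orbT.
Qed.

Lemma closed_walk_edge G x y V t :
  edge G x y -> closed_walk G y V t ->
  closed_walk G x (y :: V) (len G x y *+ 2 + t).
Proof.
move=> exy [p [pp pl pV plen]]; exists (y :: p ++ [:: x]).
rewrite /= exy cat_path pp last_cat walk_length_cat pl /= -(edge_sym G) exy.
rewrite -(len_sym exy); split=> //.
  by move=> v; rewrite !inE mem_cat => /orP[->|/pV]; rewrite ?inE ?orbT //
     => /orP[]->; rewrite ?orbT.
by rewrite mulr2n; lra.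
Qed.

End Routes.

(** * Teams of agents: shared information, cost and optimum *)

Section Exploration.
Variables (R : realType) (k : nat).
Implicit Types (G : wgraph R) (S : schedule R k) (t u e : R) (s v w : nat).

Lemma visited_le G s S t t' v : t <= t' -> visited G s S t v -> visited G s S t' v.
Proof. by move=> tt' [i [u [ut au]]]; exists i, u; split=> //; lra. Qed.

Lemma visited_potential G phi s S t v :
  potential G phi -> feasible G s S -> visited G s S t v -> phi v - phi s <= t.
Proof.
move=> pot fS [i [u [ut au]]].
by have := at_node_potential pot (fS i) au; lra.
Qed.

(* Two runs can only diverge through a departure, and its effect is seen no
   sooner than [e] later, so agreement extends by steps of length [e]. *)
Lemma same_information_until (C : wgraph R -> Prop)
    (A : wgraph R -> nat -> schedule R k) G1 G2 s e T :
  online_algorithm C A -> C G1 -> C G2 -> s \in nodes G1 -> s \in nodes G2 ->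
  0 < e -> (forall x y, edge G1 x y -> e <= len G1 x y) ->
  (forall x y, edge G2 x y -> e <= len G2 x y) ->
  (forall v w, visited G1 s (A G1 s) T v -> incident G1 v w = incident G2 v w) ->
  same_information s G1 (A G1 s) G2 (A G2 s) T.
Proof.
move=> [feas online] C1 C2 s1 s2 e0 le1 le2 inc.
have f1 := feas _ _ C1 s1; have f2 := feas _ _ C2 s2.
suff agree (m : nat) t : t < m%:R * e -> t <= T ->
    forall v, visited G1 s (A G1 s) t v <-> visited G2 s (A G2 s) t v.
  split=> // u v uT; apply: (agree (Num.truncn (u / e)).+1) => //.
  by rewrite -ltr_pdivrMr // truncnS_gt.
elim: m t => [|m IH] t.
  rewrite mul0r => t0 _ v; split=> -[i [u [ut au]]].
    by have := at_node_ge (f1 i) au; lra.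
  by have := at_node_ge (f2 i) au; lra.
rewrite -natr1 mulrDl mul1r => lt tT v.
have before u : u <= t - e -> forall w,
    visited G1 s (A G1 s) u w <-> visited G2 s (A G2 s) u w.
  by move=> ut; apply: IH; lra.
have inc1 w w' : visited G1 s (A G1 s) (t - e) w ->
    incident G1 w w' = incident G2 w w'.
  by move=> vw; apply: inc; apply: visited_le vw; lra.
have dep i : departures (A G1 s i) (t - e) = departures (A G2 s i) (t - e).
  by apply: online => //; split=> // u w ut; exact: before.
split=> -[i [u [ut au]]]; exists i.
  have inc_i y w u' : u' <= t - e -> at_node G1 s 0 (A G1 s i) y u' ->
      incident G1 y w = incident G2 y w.
    by move=> u't ay; apply: inc1; exists i, u'.
  have [|u' u't au'] := same_departures_visit (v := v) le1 inc_i (f1 i) (f2 i) (dep i).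
    by exists u; [exact: ut | exact: au].
  by exists u'.
have inc_i y w u' : u' <= t - e -> at_node G2 s 0 (A G2 s i) y u' ->
    incident G2 y w = incident G1 y w.
  by move=> u't ay; rewrite inc1 //; apply/before => //; exists i, u'.
have [|u' u't au'] := same_departures_visit (v := v) le2 inc_i (f2 i) (f1 i) (esym (dep i)).
  by exists u; [exact: ut | exact: au].
by exists u'.
Qed.

Lemma cost_ge G s S a :
  (forall t, finished G s S t -> a <= t) -> (a%:E <= cost G s S)%E.
Proof.
by move=> le; apply: le_ereal_inf_tmp => _ [t fin <-]; rewrite lee_fin; exact: le.
Qed.

Lemma finished_ge0 G s S t : (0 < k)%N -> feasible G s S -> finished G s S t -> 0 <= t.
Proof.
by move=> k0 fS [_ /(_ (Ordinal k0))]; exact: at_node_ge.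
Qed.

Lemma opt_ge0 G s : (0 < k)%N -> (0 <= opt k G s)%E.
Proof.
move=> k0; apply: le_ereal_inf_tmp => _ [S fS <-]; apply: cost_ge => t.
exact: finished_ge0 k0 fS.
Qed.

(** Two agents walk the two tours while all others stay at [s]. *)
Lemma opt_le G s V0 V1 T : (2 <= k)%N ->
  closed_walk G s V0 T -> closed_walk G s V1 T ->
  {subset nodes G <= V0 ++ V1} -> (opt k G s <= T%:E)%E.
Proof.
move=> k2 [p0 [pp0 pl0 pV0 plen0]] [p1 [pp1 pl1 pV1 plen1]] cover.
pose i0 : 'I_k := Ordinal (ltnW k2); pose i1 : 'I_k := Ordinal k2.
pose S : schedule R k := fun i => if i == i0 then walk_route G s 0 p0 else
  if i == i1 then walk_route G s 0 p1 else [::].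
have T0 : 0 <= T by have := walk_length_ge0 pp0; lra.
have fS : feasible G s S.
  by move=> i; rewrite /S; do 2?[case: ifP => _] => //; exact: walk_route_feasible.
suff fin : finished G s S T.
  apply: (@le_trans _ _ (cost G s S)); first by apply: ereal_inf_lbound; exists S.
  by apply: ereal_inf_lbound; exists T.
split=> [v /cover|i]; last first.
  have back p : last s p = s -> walk_length G s p <= T ->
      at_node G s 0 (walk_route G s 0 p) s T.
    by move=> pl plen; rewrite -[in X in at_node _ _ _ _ X]pl walk_route_last ?add0r.
  by rewrite /S; do 2?[case: ifP => _]; [exact: back | exact: back | rewrite /= eqxx].
rewrite mem_cat => /orP[/pV0 vp|/pV1 vp].
  have [u le_u au] := walk_route_visits 0 pp0 vp.
  by exists i0, u; rewrite /S eqxx; split=> //; lra.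
have [u le_u au] := walk_route_visits 0 pp1 vp.
by exists i1, u; rewrite /S; split=> //; lra.
Qed.

End Exploration.

(** Serves to list the links of the cycle [0, ..., m]: rotating its node list moves 0 behind an
    [iota]. *)
Lemma zip_iota_rcons (a m z : nat) :
  zip (iota a m.+1) (rcons (iota a.+1 m) z) =
  rcons [seq (i, i.+1) | i <- iota a m] (a + m, z)%N.
Proof.
elim: m a => [|m IH] a; first by rewrite addn0.
by move: (IH a.+1); rewrite /= addSnnS => ->.
Qed.

(** * The graphs of the adversary *)

Section Family.
Variables (R : realType) (n T j : nat) (eps l : R).
Hypotheses (j_gt0 : (0 < j)%N) (ltjT : (j.+1 < T)%N).
Hypotheses (eps_gt0 : 0 < eps) (l_gt0 : 0 < l).

Definition tadpole_link (x y : nat) : bool :=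
  [|| (y == x.+1) && (x <= j), (x == j.+1) && (y == 0) |
      (x == 1) && (T <= y < T + n)]%N.

Definition tadpole_edge (x y : nat) : bool := tadpole_link x y || tadpole_link y x.

(** On edges, [x + y == 1] singles out the edge between 0 and 1, which leaves the closing edge as
    the only other one at 0. Its length [l] will be 1 on the long cycle and [eps] on the shortened
    one. *)
Definition tadpole_len (x y : nat) : R :=
  if (x + y == 1)%N then 1 else if (x == 0)%N || (y == 0)%N then l else eps.

Definition tadpole_nodes : {fset nat} := [fset x in iota 0 j.+2 ++ iota T n]%fset.

Lemma mem_tadpole_nodes x :
  (x \in tadpole_nodes) = (x <= j.+1)%N || (T <= x < T + n)%N.
Proof. by rewrite in_fset mem_cat !mem_iota. Qed.

Lemma tadpole_edge_sym : symmetric tadpole_edge.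
Proof. by move=> x y; rewrite /tadpole_edge orbC. Qed.

Lemma tadpole_edge_irr : irreflexive tadpole_edge.
Proof. by move=> x; rewrite /tadpole_edge /tadpole_link; lia. Qed.

Lemma tadpole_edge_nodes x y : tadpole_edge x y -> x \in tadpole_nodes.
Proof. by rewrite mem_tadpole_nodes /tadpole_edge /tadpole_link; lia. Qed.

Lemma tadpole_len_sym x y : tadpole_edge x y -> tadpole_len x y = tadpole_len y x.
Proof. by rewrite /tadpole_len addnC orbC. Qed.

Lemma tadpole_len_gt0 x y : tadpole_edge x y -> 0 < tadpole_len x y.
Proof. by rewrite /tadpole_len; do 2?[case: ifP]. Qed.

Lemma tadpole_connected : {in tadpole_nodes &, forall x y,
  exists2 p, path tadpole_edge x p & last x p = y}.
Proof.
pose reach x y := exists2 p, path tadpole_edge x p & last x p = y.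
have reach_trans x y z : reach x y -> reach y z -> reach x z.
  move=> [p pp <-] [q qq <-]; exists (p ++ q); last by rewrite last_cat.
  by rewrite cat_path pp.
have reach_sym x y : reach x y -> reach y x.
  move=> [p pp <-]; exists (rev (belast x p)); last first.
    by case: p {pp} => //= z p; rewrite rev_cons last_rcons.
  by rewrite rev_path (eq_path (e' := tadpole_edge)) // => u v; rewrite tadpole_edge_sym.
have reach_edge x y : tadpole_edge x y -> reach x y.
  by move=> exy; exists [:: y]; rewrite //= exy.
have up i : (i <= j.+1)%N -> reach 0%N i.
  elim: i => [|i IH] ij; first by exists [::].
  apply: (reach_trans _ i); first by apply: IH; lia.
  by apply: reach_edge; rewrite /tadpole_edge /tadpole_link; lia.
have from0 x : x \in tadpole_nodes -> reach 0%N x.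
  rewrite mem_tadpole_nodes => /orP[/up //|xT].
  apply: (reach_trans _ 1%N); first exact: up.
  by apply: reach_edge; rewrite /tadpole_edge /tadpole_link; lia.
by move=> x y /from0/reach_sym x0 /from0; exact: reach_trans.
Qed.

Definition tadpole_graph : wgraph R :=
  WGraph tadpole_edge_sym tadpole_edge_irr tadpole_edge_nodes tadpole_len_sym
    tadpole_len_gt0 tadpole_connected.

Lemma tadpole_graphP : tadpole n tadpole_graph.
Proof.
have size_tails : size [seq (1%N, [:: t]) | t <- iota T n] == n.
  by rewrite size_map size_iota.
exists (iota 0 j.+2), (Tuple size_tails) => V E.
have VE : V = iota 0 j.+2 ++ iota T n.
  rewrite /V; congr (_ ++ _) => /=.
  by elim: (iota T n) => //= t s ->.
split.
- by rewrite size_iota; lia.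
- by apply/allP => /= _ /mapP[t _ ->].
- rewrite VE cat_uniq !iota_uniq andbT; apply/hasPn => x.
  by rewrite !mem_iota; lia.
- by move=> x; rewrite VE mem_tadpole_nodes mem_cat !mem_iota /=; lia.
suff linkE x y : tadpole_link x y = ((x, y) \in E).
  by move=> x y; rewrite -/E /= /tadpole_edge !linkE.
rewrite /E mem_cat; have -> : ((x, y) \in cycle_links (iota 0 j.+2)) =
    ((y == x.+1) && (x <= j) || (x == j.+1) && (y == 0))%N.
  have rotE : rot 1 (iota 0 j.+2) = rcons (iota 1 j.+1) 0%N by exact: rot1_cons.
  rewrite /cycle_links rotE (zip_iota_rcons 0 j.+1) mem_rcons inE orbC.
  congr (_ || _); apply/mapP/andP => [[i ij [-> ->]]|[/eqP-> xj]].
    by move: ij; rewrite mem_iota.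
  by exists x; rewrite ?mem_iota.
rewrite /tadpole_link orbA; congr (_ || _).
rewrite /=.
have -> : [seq path_links (a.1 :: a.2) | a <- [seq (1%N, [:: t]) | t <- iota T n]]
  = [seq [:: (1%N, t)] | t <- iota T n] by rewrite -map_comp.
rewrite flatten_map1.
apply/andP/mapP => [[/eqP-> yT]|[t tT [-> ->]]]; last by move: tT; rewrite mem_iota.
by exists y; rewrite ?mem_iota.
Qed.

Lemma tadpole_len_eps x y : (0 < x)%N -> (0 < y)%N -> tadpole_len x y = eps.
Proof. by case: x y => [|x] [|y] // _ _; rewrite /tadpole_len addSn addnS. Qed.

Lemma tadpole_edge10 : edge tadpole_graph 1 0.
Proof. by rewrite /= /tadpole_edge /tadpole_link; lia. Qed.

Lemma tadpole_edge_last : edge tadpole_graph j.+1 0.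
Proof. by rewrite /= /tadpole_edge /tadpole_link; lia. Qed.

Lemma tadpole_len_ge x y :
  eps <= 1 -> eps <= l -> edge tadpole_graph x y -> eps <= len tadpole_graph x y.
Proof. by move=> e1 el _; rewrite /= /tadpole_len; do 2?[case: ifP => _]. Qed.

(* Cutting the distance from node 1 off at [y] <= 1 makes it 1-Lipschitz across
   both edges at node 0. *)
Definition height (y : R) (x : nat) : R :=
  if x == 0%N then y else if (T <= x)%N then 0 else Num.min (x.-1%:R * eps) y.

Lemma height0 y : height y 0 = y. Proof. by []. Qed.

Lemma height_path y i : (i <= j)%N -> height y i.+1 = Num.min (i%:R * eps) y.
Proof. by move=> ij; rewrite /height /= ifF //; lia. Qed.

Lemma height1 y : 0 <= y -> height y 1 = 0.
Proof. by move=> y0; rewrite height_path // mul0r; apply/min_idPl. Qed.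

Lemma height_end y : y <= j%:R * eps -> height y j.+1 = y.
Proof. by move=> yj; rewrite height_path //; apply/min_idPr. Qed.

Lemma height_tail y x : (T <= x)%N -> height y x = 0.
Proof. by move=> Tx; rewrite /height Tx ifF //; lia. Qed.

Lemma height_link y x w : 0 <= y -> y <= 1 -> y <= j%:R * eps ->
  tadpole_link x w -> `|height y w - height y x| <= tadpole_len x w.
Proof.
move=> y0 y1 yj /or3P[/andP[/eqP-> xj]|/andP[/eqP-> /eqP->]|/and3P[/eqP-> Tw _]].
- case: x xj => [|x] xj; first by rewrite height0 height1 // ler_norml /tadpole_len /=; lra.
  rewrite tadpole_len_eps // !height_path //; last by lia.
  rewrite -natr1 mulrDl mul1r /Num.min ler_norml.
  by case: ltP => ?; case: ltP => ?; have := eps_gt0; lra.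
(* Both ends of the closing edge have height [y], thanks to [y <= j%:R * eps]. *)
- rewrite height0 height_end // subrr normr0 /tadpole_len.
  by do 2?[case: ifP => _] => //; exact: ltW.
- rewrite height1 // height_tail // subr0 normr0 tadpole_len_eps //; last lia.
  exact: ltW.
Qed.

Lemma height_potential y : 0 <= y -> y <= 1 -> y <= j%:R * eps ->
  potential tadpole_graph (height y).
Proof.
move=> y0 y1 yj x w exw; apply: le_trans (ler_norm _) _.
case/orP: (exw) => lk; first exact: height_link.
by rewrite (len_sym exw) distrC; exact: height_link.
Qed.

(** * Tours for the optimum and lower bounds on the cost *)

Lemma closed_walk_tails :
  closed_walk tadpole_graph 1 (iota T n) (n%:R * (eps *+ 2)).
Proof.
suff H m t : (T <= t)%N -> (t + m <= T + n)%N ->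
    closed_walk tadpole_graph 1 (iota t m) (m%:R * (eps *+ 2)) by apply: H; lia.
elim: m t => [|m IH] t Tt tm; first by rewrite mul0r; exact: closed_walk_nil.
rewrite -nat1r mulrDl mul1r; apply: (@closed_walk_cat _ _ _ [:: t]); last by apply: IH; lia.
rewrite -(@tadpole_len_eps 1 t) //; last lia.
rewrite -[_ *+ 2]addr0; apply: (closed_walk_edge _ (closed_walk_nil _ _)).
by rewrite /= /tadpole_edge /tadpole_link; lia.
Qed.

(** The path is walked out and back around a tour based at its far end. That tour is empty for the
    agent that serves the path, and crosses the closing edge in the optimum of the shortened
    cycle. *)
Lemma closed_walk_path V t :
  closed_walk tadpole_graph j.+1 V t ->
  closed_walk tadpole_graph 1 (iota 2 j ++ V) (j%:R * (eps *+ 2) + t).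
Proof.
move=> walk; suff H i : (i <= j)%N ->
    closed_walk tadpole_graph (j.+1 - i) (iota (j.+2 - i) i ++ V) (i%:R * (eps *+ 2) + t).
  by have := H j (leqnn _); rewrite subSnn subSn // subSnn.
elim: i => [|i IH] ij; first by rewrite mul0r add0r subn0.
rewrite -nat1r mulrDl mul1r -addrA -{1}(@tadpole_len_eps (j.+1 - i.+1) (j.+1 - i)); [|lia..].
have -> : (j.+2 - i.+1 = j.+1 - i)%N by lia.
rewrite [iota _ _]/= -subSn; last lia.
apply: closed_walk_edge; last by apply: IH; lia.
by rewrite /= /tadpole_edge /tadpole_link; lia.
Qed.

(** One agent serves the tails and the path; the other only has to fetch node 0, from whichever side
    is cheaper in the instance. *)
Lemma tadpole_opt_le k V t : (2 <= k)%N ->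
  (n%:R + j%:R) * (eps *+ 2) <= t -> closed_walk tadpole_graph 1 V t ->
  0%N \in V -> (opt k tadpole_graph 1 <= t%:E)%E.
Proof.
move=> k2 le_t walk V0.
have := closed_walk_path (closed_walk_nil _ _); rewrite cats0 addr0.
move=> /(closed_walk_cat closed_walk_tails); rewrite -mulrDl => /(closed_walk_le le_t).
move=> /(closed_walk_cat (closed_walk_start _ _)); rewrite add0r => walk0.
apply: (opt_le k2 walk0 walk) => x; rewrite mem_tadpole_nodes !mem_cat !mem_iota inE.
case: x => [|x]; first by rewrite V0 !orbT.
by move=> xn; apply/orP; left; lia.
Qed.

(** Node 0 has height [y] and the start height 0; the negated potential bounds the descent. *)
Lemma tadpole_return k (S : schedule R k) y i u t :
  0 <= y -> y <= 1 -> y <= j%:R * eps -> feasible tadpole_graph 1 S ->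
  at_node tadpole_graph 1 0 (S i) 0 u -> u <= t ->
  finished tadpole_graph 1 S t -> u + y <= t.
Proof.
move=> y0 y1 yj fS au ut [_ /(_ i) home].
have pot := potentialN (height_potential y0 y1 yj).
have := at_node_potential2 pot (fS i) au home ut.
by rewrite height0 height1 //; lra.
Qed.

(** As node 0 is unvisited at time [d], the exploration ends later, and the agent inside the edge
    must first come out at 0 at time [d + 1]. *)
Lemma tadpole_cost_crossing k (S : schedule R k) y i d :
  0 <= y -> y <= 1 -> y <= j%:R * eps -> feasible tadpole_graph 1 S ->
  has_leg 1 (S i) 1 d 0 -> ~ visited tadpole_graph 1 S d 0 ->
  ((d + 1 + y)%:E <= cost tadpole_graph 1 S)%E.
Proof.
move=> y0 y1 yj fS hl unvisited; apply: cost_ge => t fin.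
have vt : visited tadpole_graph 1 S t 0.
  by apply: fin.1; rewrite mem_tadpole_nodes.
have dt : d < t.
  by rewrite ltNge; apply/negP => td; apply: unvisited; exact: visited_le vt.
have le_t := has_leg_inside (fS i) hl (fin.2 i) dt.
have [_ _ _ a0] := has_leg_departs (fS i) hl.
exact: tadpole_return a0 le_t fin.
Qed.

(** The last edge into node 0 has length at least 1 and is not entered before time 1: from node 1 by
    assumption, from the far end because the path has length at least 1. Going home takes at least 1
    more. *)
Lemma tadpole_cost_no_crossing k (S : schedule R k) :
  1 <= l -> 1 <= j%:R * eps -> feasible tadpole_graph 1 S ->
  (forall i d, has_leg 1 (S i) 1 d 0 -> 1 <= d) ->
  (3%:E <= cost tadpole_graph 1 S)%E.
Proof.
move=> l1 j1 fS late; apply: cost_ge => t fin.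
have pot := height_potential ler01 (lexx _) j1.
have [|i [u [ut au]]] := fin.1 0%N; first by rewrite mem_tadpole_nodes.
have := tadpole_return ler01 (lexx _) j1 fS au ut fin.
suff : 2 <= u by lra.
have [x [d [hl le_u]]] := last_leg (fS i) au isT.
have [ex0 _ ax _] := has_leg_departs (fS i) hl.
have : x = 1%N \/ x = j.+1 by move: ex0; rewrite /= /tadpole_edge /tadpole_link; lia.
case=> xE; rewrite {x}xE in hl le_u ax {ex0}.
  by have := late _ _ hl; move: le_u; rewrite /= /tadpole_len /=; lra.
have := at_node_potential pot (fS i) ax.
rewrite height_end // height1 //.
move: le_u; rewrite /= /tadpole_len ifF; last by lia.
by lra.
Qed.

End Family.

(** Path nodes up to [minn j j'] have their successor in both graphs, and the tails carry the same
    labels; the graphs differ only at node 0 and beyond these path nodes. *)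
Lemma tadpole_incident (R : realType) (n T j j' : nat) (eps l l' : R)
    (j_gt0 : (0 < j)%N) (j'_gt0 : (0 < j')%N) (ltjT : (j.+1 < T)%N)
    (ltj'T : (j'.+1 < T)%N) (eps_gt0 : 0 < eps) (l_gt0 : 0 < l) (l'_gt0 : 0 < l') v w :
  (0 < v)%N -> ((v <= minn j j') || (T <= v))%N ->
  incident (tadpole_graph n j_gt0 ltjT eps_gt0 l_gt0) v w =
  incident (tadpole_graph n j'_gt0 ltj'T eps_gt0 l'_gt0) v w.
Proof.
move=> v0 vj; rewrite /incident /=.
have -> : tadpole_edge n T j' v w = tadpole_edge n T j v w.
  by rewrite /tadpole_edge /tadpole_link; lia.
case: ifP => // evw; congr Some.
rewrite /tadpole_len; case: ifP => // vw.
rewrite ifF; first by rewrite ifF //; move: evw; rewrite /tadpole_edge /tadpole_link; lia.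
by move: evw; rewrite /tadpole_edge /tadpole_link; lia.
Qed.

(** Passes from extended reals to a real inequality. The strict gap between [c] and [q] will absorb
    errors of order [eps]. *)
Lemma competitive_ratio_bound (R : realType) (k : nat) (C : wgraph R -> Prop)
    (A : wgraph R -> nat -> schedule R k) (q : R) :
  (0 < k)%N -> 1 < q -> (competitive_ratio C A < q%:E)%E ->
  exists c, [/\ 1 <= c, c < q & forall G s (a b : R), C G -> s \in nodes G -> 0 < b ->
    (a%:E <= cost G s (A G s))%E -> (opt k G s <= b%:E)%E -> a <= c * b].
Proof.
move=> k0 q1 ratio_lt.
have [c [c1 cq ratio_le]] :
    exists c, [/\ 1 <= c, c < q & (competitive_ratio C A <= c%:E)%E].
  case: (competitive_ratio C A) ratio_lt => [r| |] // lt.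
    (* The maximum with 1 settles the case [a <= 0] and makes [c - 1] nonnegative for the final
       estimate. *)
    exists (Num.max 1 r); rewrite gt_max q1 -lte_fin lt !lee_fin.
    by rewrite !le_max !lexx orbT.
  by exists 1; rewrite leNye.
exists c; split=> // G s a b CG sG b0 le_cost le_opt.
have [a0|a0] := leP a 0.
  by apply: le_trans a0 _; apply: mulr_ge0; lra.
rewrite -ler_pdivrMr // -lee_fin; apply: le_trans ratio_le.
apply: le_trans (_ : cost G s (A G s) / opt k G s <= _)%E; last first.
  by apply: ereal_sup_ubound; exists G, s.
have -> : (a / b)%:E = (a%:E * (b%:E)^-1)%E by rewrite inver gt_eqF.
apply: lee_pmul => //.
- by rewrite lee_fin ltW.
- by rewrite inve_ge0 lee_fin ltW.
- by rewrite lee_pV2 // inE /= ?opt_ge0 ?lee_fin ?ltW.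
Qed.

Theorem theorem10 (R : realType) (n k : nat) (hk : (2 <= k)%N) :
  ~ exists A : wgraph R -> nat -> schedule R k,
      online_algorithm (@tadpole R n) A /\
      (competitive_ratio (@tadpole R n) A < (3%:R / 2%:R : R)%R%:E)%E.
Proof.
move=> [A [online ratio_lt]].
have q1 : 1 < 3%:R / 2%:R :> R by lra.
have [c [c1 c32 bound]] := competitive_ratio_bound (ltnW hk) q1 ratio_lt.
(* Errors in the optimum, in units of [eps]: [2 * n%:R] for the tails out and back, and 4 for the
   path edge past distance [y] and the short closing edge, both out and back. *)
pose K : R := 2 * n%:R + 4.
have K0 : 0 < K by rewrite /K; have := ler0n R n; lra.
have [N N_gt0 smallN] : exists2 N, (0 < N)%N & 3%:R / 2%:R * K < (3 - 2 * c) * N%:R.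
  exists (Num.truncn (3%:R / 2%:R * K / (3 - 2 * c))).+1 => //.
  by rewrite [ltRHS]mulrC -ltr_pdivrMr; [exact: truncnS_gt | lra].
pose eps : R := N%:R^-1.
have N0 : 0 < N%:R :> R by rewrite ltr0n.
have Neps : N%:R * eps = 1 by rewrite mulfV // gt_eqF.
have eps0 : 0 < eps by rewrite invr_gt0.
have eps1 : eps <= 1 by rewrite invf_le1 // ler1n.
have small : 3%:R / 2%:R * K * eps < 3 - 2 * c by rewrite ltr_pdivrMr.
(* Both cases end here, the one without early crossing with [y = 1]. From [y <= 1] and [1 <= c], the
   inequality would give 1 <= 2 (c - 1) + c K eps < 2 (c - 1) + (3 - 2 c) = 1. *)
have too_good (y b : R) : 0 <= y -> y <= 1 -> b <= 2 * y + K * eps ->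
    ~ 2 * y + 1 <= c * b.
  move=> y0 y1 le_b le_c.
  have Keps : 0 < K * eps by exact: mulr_gt0.
  have cb : c * b <= c * (2 * y + K * eps) by rewrite ler_wpM2l //; lra.
  have cy : (c - 1) * y <= (c - 1) * 1 by rewrite ler_wpM2l //; lra.
  have cK : c * (K * eps) <= 3%:R / 2%:R * (K * eps) by rewrite ler_wpM2r // ltW.
  clear -le_c cb cy cK small; lra.
(* Tail labels start at [N.+2] in both instances, above all path labels. *)
have ltNT : (N.+1 < N.+2)%N by [].
pose G1 := tadpole_graph n N_gt0 ltNT eps0 (@ltr01 R).
have C1 : tadpole n G1 by exact: tadpole_graphP.
have s1 : 1%N \in nodes G1 by rewrite mem_tadpole_nodes.
have f1 := online.1 _ _ C1 s1.
have [[i [d [d1 hl]]]|no_crossing] :=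
    pselect (exists i d, d < 1 /\ has_leg 1 (A G1 1%N i) 1 d 0); last first.
  have late i d : has_leg 1 (A G1 1%N i) 1 d 0 -> 1 <= d.
    by move=> hl; rewrite leNgt; apply/negP => d1; apply: no_crossing; exists i, d.
  pose b : R := 2 + K * eps.
  have b0 : 0 < b by rewrite addr_gt0 // mulr_gt0.
  apply: (too_good 1 b ler01 (lexx _)); first by rewrite /b; lra.
  have -> : 2 * 1 + 1 = 3 :> R by lra.
  apply: (bound G1 1%N) => //.
    by apply: tadpole_cost_no_crossing late; rewrite ?Neps.
  apply: (@tadpole_opt_le _ _ _ _ _ _ _ _ _ _ _ [:: 0%N]) => //.
    by rewrite mulrDl !mulrnAr Neps /b /K !mulr2n; lra.
  have edge10 : edge G1 1 0 by exact: tadpole_edge10.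
  apply: closed_walk_le (closed_walk_edge edge10 (closed_walk_nil _ _)).
  by rewrite /b /= /tadpole_len /= mulr2n; have := mulr_gt0 K0 eps0; lra.
have [_ d0 _ _] := has_leg_departs (f1 i) hl.
(* Node [J.+1], at distance [J%:R * eps], is the last path node within distance [d]. *)
have [J Jd dJ] : exists2 J, J%:R * eps <= d & d < J.+1%:R * eps.
  exists (Num.truncn (d / eps)); last by rewrite -ltr_pdivrMr // truncnS_gt.
  by rewrite -ler_pdivlMr // truncn_le divr_ge0 // ltW.
pose y : R := J%:R * eps.
have y0 : 0 <= y by rewrite mulr_ge0 // ltW.
have yd : y <= d := Jd.
have JN : (J < N)%N.
  by rewrite -(ltr_nat R) -(ltr_pM2r eps0) Neps; exact: le_lt_trans yd d1.
(* The shortened path ends at [J.+2], just past the nodes that can have been visited, so the new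
   closing edge joins two unvisited nodes. *)
have ltJT : (J.+2 < N.+2)%N by [].
pose G2 := tadpole_graph n (isT : (0 < J.+1)%N) ltJT eps0 eps0.
have C2 : tadpole n G2 by exact: tadpole_graphP.
have s2 : 1%N \in nodes G2 by rewrite mem_tadpole_nodes.
have f2 := online.1 _ _ C2 s2.
have yJ : y <= J.+1%:R * eps by lra.
have y1 : y <= 1 by lra.
(* Cut off at 1, the height excludes node 0, as [d < 1], and all path nodes beyond [J.+1]. *)
have pot1 : potential G1 (height N.+2 eps 1).
  by apply: height_potential; rewrite ?Neps.
have visited1 v : visited G1 1 (A G1 1%N) d v ->
    (0 < v)%N && ((v <= J.+1) || (N.+2 <= v))%N.
  move=> /(visited_potential pot1 f1).
  rewrite (height1 N_gt0 ltNT eps0 (@ltr01 R) ler01) subr0 /height.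
  case: v => [|v] /=; first lra.
  case: leqP => vN; last by rewrite orbT.
  rewrite orbF ge_min => /orP[vd|]; last lra.
  rewrite -(ltr_nat R) -(ltr_pM2r eps0); lra.
have same : same_information 1 G1 (A G1 1%N) G2 (A G2 1%N) d.
  apply: (same_information_until online C1 C2 s1 s2 eps0).
  - by move=> x w; exact: tadpole_len_ge.
  - by move=> x w; exact: tadpole_len_ge.
  move=> v w /visited1/andP[v0 v1]; apply: tadpole_incident => //.
  case/orP: v1 => [vJ|->]; last by rewrite orbT.
  by rewrite leq_min vJ (leq_trans vJ JN).
(* The crossing departs at [d] itself, and the agreement includes time [d]; hence it also occurs in
   [G2]. *)
have hl2 : has_leg 1 (A G2 1%N i) 1 d 0.
  have [r ->] := departures_prefix d (f2 i); apply: has_leg_cat.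
  rewrite -(online.2 _ _ _ C1 C2 s1 s2 _ same).
  exact: departures_has_leg (f1 i) hl.
pose b : R := 2 * y + K * eps.
have b0 : 0 < b by have := mulr_gt0 K0 eps0; rewrite /b; lra.
apply: (too_good y b) => //.
(* Rounding down gives [y <= d], so the crossing bound is at least [2 * y + 1]. *)
apply: (@le_trans _ _ (d + 1 + y)); first lra.
apply: (bound G2 1%N) => //.
  apply: tadpole_cost_crossing hl2 _ => //.
  by move=> /(same.1 _ _ (lexx d))/visited1.
have edge0 : edge G2 J.+2 0 by exact: tadpole_edge_last.
have walk := closed_walk_path (closed_walk_edge edge0 (closed_walk_nil G2 0)).
apply: (tadpole_opt_le hk _ (closed_walk_le _ walk)).
- by rewrite /b /K /y -(natr1 J); lra.
- rewrite /b /K /y -(natr1 J) /= /tadpole_len addn0 /= !mulr2n.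
  by have := mulr_ge0 (ler0n R n) (ltW eps0); lra.
- by rewrite mem_cat inE orbT.
Qed.
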